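(* For $n\geq 2$, the number of permutations $\pi\in\mathcal{S}_n$ avoiding $321$ with $\theta^2(\pi)=\pi$ equals $F_{n+1}$, the $(n+1)$-st Fibonacci number.
   Context: $\mathcal{S}_n$ is the symmetric group on $[n]$, permutations in one-line notation $\pi_1\cdots\pi_n$. A permutation avoids a pattern $\tau$ if it has no subsequence order-isomorphic to $\tau$. The standard cycle notation of $\pi$ writes each cycle (fixed points included) with its largest element first and orders cycles by increasing largest element. The fundamental bijection $\theta:\mathcal{S}_n\to\mathcal{S}_n$ maps $\pi$ to the permutation whose one-line notation is obtained by erasing the parentheses of the standard cycle notation of $\pi$; $\theta^2=\theta\circ\theta$. Fibonacci numbers: $F_0=0$, $F_1=F_2=1$, $F_m=F_{m-1}+F_{m-2}$. *)

(* Defs.v *)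
From mathcomp Require Import all_boot.
From mathcomp Require Import perm.

Set Implicit Arguments.
Unset Strict Implicit.
Unset Printing Implicit Defensive.

(* Permutations of [n] are elements of 'S_n = {perm 'I_n}, i.e. letters and
   positions are numbered 0, ..., n - 1; the i-th letter of the one-line
   notation of s is s i. *)

Definition contains (k n : nat) (tau : 'S_k) (s : 'S_n) : bool :=
  [exists p : {ffun 'I_k -> 'I_n},
     [forall i : 'I_k, forall j : 'I_k, (i < j) ==> (p i < p j)] &&
     [forall i : 'I_k, forall j : 'I_k, (s (p i) < s (p j)) == (tau i < tau j)]].

Definition avoids (k n : nat) (tau : 'S_k) (s : 'S_n) : bool :=
  ~~ contains tau s.

Definition pattern321 : 'S_3 := perm (@rev_ord_inj 3).

Section FundamentalBijection.

Variable n : nat.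
Implicit Type s : 'S_n.

Definition cycle_max s (m : 'I_n) : bool :=
  [forall j in porbit s m, j <= m].

Definition cycle_from s (m : 'I_n) : seq 'I_n := traject s m #|porbit s m|.

(* [enum 'I_n] is increasing, so the cycles come in increasing order of their
   largest elements. *)
Definition standard_cycles s : seq (seq 'I_n) :=
  [seq cycle_from s m | m <- enum 'I_n & cycle_max s m].

Definition theta_word s : seq 'I_n := flatten (standard_cycles s).

Lemma mem_cycle_from s m x : (x \in cycle_from s m) = (x \in porbit s m).
Proof. by rewrite porbit_traject. Qed.

Lemma cycle_max_uniq s m1 m2 :
  cycle_max s m1 -> cycle_max s m2 -> m1 \in porbit s m2 -> m1 = m2.
Proof.
move=> /forall_inP h1 /forall_inP h2 m12.
apply/val_inj/eqP; rewrite eqn_leq h2 //= h1 //.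
by rewrite porbit_sym.
Qed.

Lemma theta_word_uniq s : uniq (theta_word s).
Proof.
rewrite /theta_word /standard_cycles.
have: uniq [seq m <- enum 'I_n | cycle_max s m] by rewrite filter_uniq ?enum_uniq.
have: all (cycle_max s) [seq m <- enum 'I_n | cycle_max s m] by exact: filter_all.
elim: [seq m <- _ | _] => //= m r IHr /andP[mm rm] /andP[mr ur].
rewrite cat_uniq IHr // andbT uniq_traject_porbit /=.
apply/hasPn => x /flatten_mapP [m' m'r]; rewrite mem_cycle_from => xm'.
apply/negP; rewrite mem_cycle_from => xm; case/negP: mr.
suff -> : m = m' by [].
apply: (cycle_max_uniq mm (allP rm _ m'r)).
by move: xm xm'; rewrite -!eq_porbit_mem => /eqP <-; rewrite eq_sym.
Qed.

Lemma mem_theta_word s x : x \in theta_word s.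
Proof.
case: (@arg_maxnP _ x [in porbit s x] val (porbit_id s x)) => m mx hm.
have exm : porbit s m = porbit s x by apply/eqP; rewrite eq_porbit_mem.
apply/flatten_mapP; exists m.
  rewrite mem_filter mem_enum andbT; apply/forall_inP => j.
  by rewrite exm => /hm.
by rewrite mem_cycle_from exm porbit_id.
Qed.

Lemma size_theta_word s : size (theta_word s) = n.
Proof.
rewrite -(card_uniqP (theta_word_uniq s)) -[RHS]card_ord.
by apply: eq_card => x; rewrite mem_theta_word.
Qed.

Definition theta_fun s (i : 'I_n) : 'I_n := nth i (theta_word s) i.

Lemma theta_fun_inj s : injective (theta_fun s).
Proof.
move=> i j; rewrite /theta_fun (set_nth_default i j) ?size_theta_word //.
move/eqP; rewrite nth_uniq ?size_theta_word ?theta_word_uniq //.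
by move/eqP/val_inj.
Qed.

Definition theta s : 'S_n := perm (@theta_fun_inj s).

End FundamentalBijection.

Fixpoint fib (m : nat) : nat :=
  match m with
  | 0 => 0
  | 1 => 1
  | (m1.+1 as m2).+1 => fib m2 + fib m1
  end.

(* Main.v *)
Require Import Defs.
From mathcomp Require Import all_boot.
From mathcomp Require Import fingroup perm.
From mathcomp Require Import zify.

Set Implicit Arguments.
Unset Strict Implicit.
Unset Printing Implicit Defensive.

(* Put [t = theta s] and suppose that [theta t = s]. If [m] is the largest
   letter, the word of [t] ends with the cycle [m, s m, ...] of [m] under [s],
   and the word of [s] ends with the cycle [m, t m, ...] of [m] under [t]. The
   last letter of the former is the preimage of [m] under [s], so that [t m] is
   the place [a] of [m] in [s]: the word of [s] reads [m a ...] from place [a]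
   on. As [s] avoids 321, its letters after [m] increase from [a], which forces
   [s m >= m - 1]. Thus [s] either fixes [m] or swaps it with [m - 1], and by
   descent [s] is a product of disjoint adjacent transpositions. Conversely
   [theta] fixes all such permutations, and Fibonacci numbers count them. *)

Lemma containsP k n (tau : 'S_k) (s : 'S_n) :
  reflect (exists2 p : {ffun 'I_k -> 'I_n}, {homo p : i j / i < j}
             & forall i j, (s (p i) < s (p j)) = (tau i < tau j))
          (contains tau s).
Proof.
apply: (iffP existsP) => -[p].
  by case/andP=> /'forall_'forall_implyP pI /'forall_'forall_eqP pE; exists p.
move=> pI pE; exists p; apply/andP; split; first exact/'forall_'forall_implyP.
exact/'forall_'forall_eqP.
Qed.

Lemma pattern321_lt (i j : 'I_3) : (pattern321 i < pattern321 j) = (j < i).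
Proof. by case: i j => i ? [j ?]; rewrite !permE /=; lia. Qed.

Lemma avoids321P n (s : 'S_n) :
  reflect (forall i j k : 'I_n, i < j < k -> s j < s i -> s j < s k)
          (avoids pattern321 s).
Proof.
apply: (iffP negP) => [noP i j k /andP[ij jk] sji | increase].
  rewrite ltnNge; apply/negP => skj; apply/noP/containsP.
  have {}skj : s k < s j.
    by rewrite ltn_neqAle skj andbT val_eqE (inj_eq perm_inj) -val_eqE gtn_eqF.
  by exists [ffun x : 'I_3 => tnth [tuple i; j; k] x] => [x y | x y];
    rewrite ?pattern321_lt; case: x y => -[|[|[|//]]] ? [[|[|[|//]]] ?];
    rewrite !ffunE !(tnth_nth i) /=; lia.
case/containsP => p pI pE.
have [x0 x1 x2] : [/\ 0 < 3, 1 < 3 & 2 < 3] by [].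
have := increase (p (Ordinal x0)) (p (Ordinal x1)) (p (Ordinal x2)).
by rewrite !pI // !pE !pattern321_lt /= => /(_ isT isT).
Qed.

Lemma avoids321_leq_after n (s : 'S_n) (a c j : 'I_n) :
    avoids pattern321 s -> a < c <= j ->
    (forall i : 'I_n, c <= i <= j -> s i < s a) ->
  s c + (j - c) <= s j.
Proof.
move=> /avoids321P avs /andP[ac cj] below_sa.
move dE: (j - c) => d; elim: d j dE cj below_sa => [|d IHd] j dE cj below_sa.
  by rewrite addn0 (_ : j = c) //; apply/val_inj => /=; lia.
have j1n : j.-1 < n by have := ltn_ord j; lia.
pose j1 := Ordinal j1n.
have sj1 : s c + d <= s j1.
  by apply: IHd => [||i /andP[ci /= ij]]; rewrite ?below_sa /=; lia.
have : s j1 < s j by apply: (avs a); rewrite ?below_sa /=; lia.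
by lia.
Qed.

Lemma mem_take_enum_ord n k (x : 'I_n) : (x \in take k (enum 'I_n)) = (x < k).
Proof. by rewrite in_take ?mem_enum // index_enum_ord. Qed.

Lemma mem_drop_enum_ord n k (x : 'I_n) : (x \in drop k (enum 'I_n)) = (k <= x).
Proof.
rewrite -(mem_map val_inj) map_drop val_enum_ord drop_iota mem_iota /=.
by have := ltn_ord x; lia.
Qed.

Definition stable_below n k (s : 'S_n) := forall x : 'I_n, x < k -> s x < k.

Lemma stable_below_porbit n k (s : 'S_n) (x y : 'I_n) :
  stable_below k s -> y \in porbit s x -> (y < k) = (x < k).
Proof.
move=> sk; have forward z w : w \in porbit s z -> z < k -> w < k.
  by case/porbitP=> i -> zk; rewrite permX; elim: i => //= i; apply: sk.
by move=> yx; apply/idP/idP; apply: forward; rewrite // porbit_sym.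
Qed.

Lemma stable_below_shrink n h k (s : 'S_n) :
    h <= k -> stable_below k s ->
    (forall x : 'I_n, h <= x < k -> h <= s x /\ s (s x) = x) ->
  stable_below h s.
Proof.
move=> hk sk inv x xh; rewrite ltnNge; apply/negP => hsx.
have sxk : s x < k by apply: sk; lia.
have [] := inv (s x); first by rewrite hsx.
move=> hssx /perm_inj ssx; move: hssx; rewrite ssx; lia.
Qed.

Section ThetaWord.

Variables (n : nat) (s : 'S_n).

Definition cycles_word (r : seq 'I_n) : seq 'I_n :=
  flatten [seq cycle_from s m | m <- r & cycle_max s m].

Lemma cycles_wordP r x :
  reflect (exists m, [/\ m \in r, cycle_max s m & x \in porbit s m])
          (x \in cycles_word r).
Proof.
apply: (iffP flatten_mapP) => [[m] | [m [mr mmax xm]]].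
  by rewrite mem_filter mem_cycle_from => /andP[mmax mr] xm; exists m.
by exists m; rewrite ?mem_filter ?mmax // mem_cycle_from.
Qed.

Lemma cycles_word_cat r1 r2 :
  cycles_word (r1 ++ r2) = cycles_word r1 ++ cycles_word r2.
Proof. by rewrite /cycles_word filter_cat map_cat flatten_cat. Qed.

Lemma theta_word_split k : theta_word s =
  cycles_word (take k (enum 'I_n)) ++ cycles_word (drop k (enum 'I_n)).
Proof. by rewrite -cycles_word_cat cat_take_drop. Qed.

Lemma theta_nth (x y : 'I_n) : theta s x = nth y (theta_word s) x.
Proof. by rewrite permE; apply: set_nth_default; rewrite size_theta_word. Qed.

Lemma mem_cycles_word_take k x : stable_below k s ->
  (x \in cycles_word (take k (enum 'I_n))) = (x < k).
Proof.
move=> sk; apply/idP/idP => [/cycles_wordP[m []] | xk].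
  by rewrite mem_take_enum_ord => mk _ /(stable_below_porbit sk) ->.
have := mem_theta_word s x; rewrite (theta_word_split k) mem_cat => /orP[//|].
case/cycles_wordP => m []; rewrite mem_drop_enum_ord => km _.
by move=> /(stable_below_porbit sk); lia.
Qed.

Lemma take_theta_word k : k <= n -> stable_below k s ->
  take k (theta_word s) = cycles_word (take k (enum 'I_n)).
Proof.
move=> kn sk; rewrite (theta_word_split k); apply: take_size_cat.
rewrite -[RHS](size_takel (s := enum 'I_n)) ?size_enum_ord //.
apply/perm_size/uniq_perm; rewrite ?take_uniq ?enum_uniq //.
  have := theta_word_uniq s.
  by rewrite (theta_word_split k) cat_uniq => /andP[].
by move=> x; rewrite mem_cycles_word_take // mem_take_enum_ord.
Qed.

Lemma stable_below_theta k : stable_below k s -> stable_below k (theta s).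
Proof.
have [kn | nk] := leqP k n => [sk x xk|]; last first.
  by move=> _ x _; apply: leq_trans (ltn_ord _) (ltnW nk).
rewrite (theta_nth x x) -(nth_take _ xk) take_theta_word //.
rewrite -(mem_cycles_word_take _ sk) mem_nth // -take_theta_word //.
by rewrite size_takel // size_theta_word.
Qed.

(* The places up to [m] hold the cycles with maxima up to [m], the one of [m]
   coming last. *)
Lemma theta_last_cycle (m : 'I_n) : stable_below m.+1 s ->
  exists a : 'I_n, [/\ a <= m, a + #|porbit s m| = m.+1
    & forall j : 'I_n, a <= j <= m -> theta s j = iter (j - a) s m].
Proof.
move=> sm; have m_max : cycle_max s m.
  by apply/forall_inP => j /(stable_below_porbit sm); lia.
pose A := cycles_word (take m (enum 'I_n)).
have wordE : take m.+1 (theta_word s) = A ++ cycle_from s m.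
  rewrite take_theta_word // (take_nth m) ?size_enum_ord // nth_ord_enum.
  by rewrite -cats1 cycles_word_cat /cycles_word /= m_max /= cats0.
have sizeE : size A + #|porbit s m| = m.+1.
  rewrite -(size_traject s m #|porbit s m|) -size_cat -wordE size_takel //.
  by rewrite size_theta_word.
have porbit_gt0 : 0 < #|porbit s m|.
  by apply/card_gt0P; exists m; apply: porbit_id.
have An : size A < n by have := ltn_ord m; lia.
exists (Ordinal An); split=> [|//|j /andP[/= Aj jm]] /=; first by lia.
rewrite (theta_nth j m) -(nth_take m (jm : j < m.+1)) wordE nth_cat ltnNge Aj.
by rewrite nth_traject //; lia.
Qed.

Lemma perm_theta_max (m : 'I_n) : stable_below m.+1 s -> s (theta s m) = m.
Proof.
case/theta_last_cycle => a [am aE ->]; last by rewrite am leqnn.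
by rewrite -iterS -[RHS](iter_porbit s) -subSn // -aE addKn.
Qed.

End ThetaWord.

Lemma theta_swap_last_cycle n (s t : 'S_n) (m : 'I_n) :
    theta s = t -> theta t = s -> stable_below m.+1 s ->
  t m <= m /\ forall j : 'I_n, t m <= j <= m -> s j = iter (j - t m) t m.
Proof.
move=> thetas thetat /[dup] /stable_below_theta; rewrite thetas => tm sm.
have [a [am _]] := theta_last_cycle tm; rewrite thetat => s_last.
suff -> : t m = a by [].
apply: (@perm_inj _ s); rewrite [RHS]s_last ?leqnn // subnn /=.
by rewrite -{1}thetas perm_theta_max.
Qed.

Lemma theta2_fix_avoids321_max n (s : 'S_n) (m : 'I_n) :
    avoids pattern321 s -> theta (theta s) = s -> stable_below m.+1 s ->
  m <= (s m).+1 /\ s (s m) = m.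
Proof.
move=> avs; move thetas: (theta s) => t thetat sm.
have tm : stable_below m.+1 t by rewrite -thetas; apply: stable_below_theta.
have stm : s (t m) = m by rewrite -thetas perm_theta_max.
have [] := theta_swap_last_cycle thetas thetat sm; set a := t m => am s_last.
have [sm_le t_last] := theta_swap_last_cycle thetat thetas tm.
have sm_ge : m <= (s m).+1.
  move: am; rewrite leq_eqVlt => /orP[/eqP/val_inj aE | am].
    by rewrite -[in s m]aE stm.
  pose c := Ordinal (leq_ltn_trans am (ltn_ord m)).
  have sc : s c = a by rewrite s_last /= ?subSnn ?leqnSn.
  suff : s c + (m - c) <= s m by rewrite sc /=; lia.
  apply: (@avoids321_leq_after _ _ a) => [//||i /andP[/= ai im]].
    by rewrite /= ltnSn.
  have : s i != s a by rewrite (inj_eq perm_inj) -val_eqE /=; lia.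
  by rewrite stm -val_eqE /=; have := sm i; lia.
split=> //; have [m_fix|] := eqVneq (s m) m; first by rewrite !m_fix.
rewrite -val_eqE /= => sm_neq_m.
rewrite -[in RHS]stm /a t_last ?sm_le ?leqnn //.
by rewrite (_ : m - s m = 1) //; lia.
Qed.

(* Applied to [s i], the bound also gives [i - 1 <= s i], so that [s] only swaps
   neighbours. *)
Definition adjacent_involution n (s : 'S_n) : bool :=
  (s * s == 1)%g && [forall i, s i <= i.+1].

Lemma adjacent_involutionP n (s : 'S_n) :
  reflect (involutive s /\ forall i, s i <= i.+1) (adjacent_involution s).
Proof.
apply: (iffP andP) => [[/eqP/permP ss /forallP s_le] | [ss s_le]]; split=> //.
- by move=> x; have := ss x; rewrite permM perm1.
- by apply/eqP/permP => x; rewrite permM perm1 ss.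
- exact/forallP.
Qed.

Lemma theta2_fix_avoids321_adjacent n (s : 'S_n) :
  avoids pattern321 s -> theta (theta s) = s -> adjacent_involution s.
Proof.
move=> avs thetas.
suff below k (i : 'I_n) : k <= n -> i < k -> stable_below k s ->
    s (s i) = i /\ s i <= i.+1.
  by apply/adjacent_involutionP; split=> i;
    case: (below n i (leqnn n) (ltn_ord i)) => // x _; apply: ltn_ord.
elim/ltn_ind: k i => -[//|k] IHk i kn ik sk; pose m := Ordinal kn.
have [m_le ssm] :=
  theta2_fix_avoids321_max avs thetas (sk : stable_below m.+1 s).
have smk := sk m (leqnn _).
have top_pair (x : 'I_n) : s m <= x < k.+1 -> x = m \/ x = s m.
  move: m_le => /= m_le xm.
  by have [xk|kx] := leqP k x; [left | right]; apply/val_inj => /=; lia.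
have [/top_pair[]->|smi] := boolP (s m <= i < k.+1).
- by rewrite ssm; split=> //=; lia.
- by rewrite !ssm; split=> //=; lia.
apply: (IHk (s m)); rewrite //; [lia | lia |].
apply: (stable_below_shrink _ sk); first by lia.
by move=> x /top_pair[]->; rewrite ?ssm; split=> //=; lia.
Qed.

Lemma adjacent_involution_avoids321 n (s : 'S_n) :
  adjacent_involution s -> avoids pattern321 s.
Proof.
case/adjacent_involutionP => ss s_le.
apply/avoids321P => i j k /andP[ij jk] sji.
have := (s_le i, s_le (s j), s_le (s k)); rewrite !ss => -[[si sj] sk]; lia.
Qed.

Lemma adjacent_involution_stable_below n (s : 'S_n) (m : 'I_n) :
  adjacent_involution s -> s m <= m -> stable_below m.+1 s.
Proof.
case/adjacent_involutionP => _ s_le smm x; rewrite ltnS leq_eqVlt.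
case/orP=> [/eqP/val_inj -> // | xm].
by have := s_le x; lia.
Qed.

Lemma theta_adjacent_involution n (s : 'S_n) :
  adjacent_involution s -> theta s = s.
Proof.
move=> adj; have [ss s_le] := adjacent_involutionP _ adj.
have theta_max (m : 'I_n) : s m <= m -> theta s m = s m.
  move=> /(adjacent_involution_stable_below adj)/perm_theta_max theta_m.
  by apply: (@perm_inj _ s); rewrite theta_m ss.
apply/permP => i; have [/theta_max // | i_lt_si] := leqP (s i) i.
pose m := s i; have smE : s m = i by rewrite /m ss.
have sm_le : s m <= m by rewrite smE ltnW.
have mE : m = i.+1 :> nat by apply/eqP; rewrite eqn_leq s_le.
have [a [am _ theta_last]] :=
  theta_last_cycle (adjacent_involution_stable_below adj sm_le).
have theta_m := theta_max m sm_le.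
have ai : a <= i.
  rewrite -ltnS -mE ltn_neqAle am andbT; apply/eqP => /val_inj aE.
  move: theta_m; rewrite theta_last ?aE ?leqnn // subnn smE => /(congr1 val) /=.
  by lia.
apply: (@perm_inj _ s); rewrite -/m -theta_m !theta_last ?am ?leqnn //.
  by rewrite mE subSn.
by rewrite ai ltnW.
Qed.

Section CountAdjacentInvolutions.

Variable n : nat.
Implicit Types (s : 'S_n) (x y : 'I_n).

Definition adjacent_involutions k : {set 'S_n} :=
  [set s | adjacent_involution s & perm_on [set i : 'I_n | i < k] s].

Lemma perm_on_ltP k s :
  reflect (forall i : 'I_n, k <= i -> s i = i)
          (perm_on [set i : 'I_n | i < k] s).
Proof.
apply: (iffP idP) => [s_on i ki | s_fix].
  by rewrite (out_perm s_on) // inE -leqNgt.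
by apply/subsetP => i; rewrite !inE ltnNge; apply: contra => /s_fix ->.
Qed.

Lemma adjacent_involutions_le1 k : k <= 1 -> adjacent_involutions k = [set 1%g].
Proof.
move=> k1; apply/setP => s; rewrite !inE.
apply/andP/eqP => [[_ /perm_on_id -> //] | ->].
  by apply/card_le1_eqP => i j; rewrite !inE => ik jk; apply/val_inj => /=; lia.
split; last exact: perm_on1.
by apply/adjacent_involutionP; split=> i; rewrite !perm1.
Qed.

Lemma tperm_commute x y s :
  tperm (s x) (s y) = tperm x y -> commute (tperm x y) s.
Proof. by rewrite /commute conjgC tpermJ => ->. Qed.

Lemma adjacent_involution_tpermM x y s :
    y = x.+1 :> nat -> commute (tperm x y) s -> s y <= y ->
  adjacent_involution s -> adjacent_involution (tperm x y * s).
Proof.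
move=> yE comm_s syy /andP[/eqP ss /forallP s_le]; apply/andP; split.
  by rewrite {1}comm_s -mulgA (mulgA (tperm x y)) tperm2 mul1g ss.
apply/forallP => i; rewrite permM.
case: tpermP => [->|->|_ _]; last exact: s_le.
- by rewrite -yE.
- by have := s_le x; lia.
Qed.

Lemma adjacent_involutions_fix_max k y : y = k :> nat ->
  adjacent_involutions k.+1 :&: [set s : 'S_n | s y == y]
    = adjacent_involutions k.
Proof.
move=> yE; apply/setP => s; rewrite !inE -andbA; congr (_ && _).
apply/andP/perm_on_ltP => [[/perm_on_ltP s_fix /eqP sy] i ki | s_fix].
  have [->//|] := eqVneq i y; rewrite -val_eqE /= => iy.
  by apply: s_fix; lia.
by split; [apply/perm_on_ltP => i ki; apply: s_fix; lia | rewrite s_fix ?yE].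
Qed.

Lemma adjacent_involution_moved_max k x y s :
    x = k :> nat -> y = k.+1 :> nat -> adjacent_involution s ->
    (forall i : 'I_n, k.+2 <= i -> s i = i) -> s y != y ->
  s y = x.
Proof.
move=> xE yE /adjacent_involutionP[ss s_le] s_fix sy_neq.
have : s y < k.+2.
  by rewrite ltnNge; apply: contra sy_neq => /s_fix; rewrite ss => <-.
have := s_le (s y); rewrite ss; move: sy_neq; rewrite -val_eqE /= => *.
by apply/val_inj => /=; lia.
Qed.

Lemma adjacent_involutions_move_max k x y : x = k :> nat -> y = k.+1 :> nat ->
  adjacent_involutions k.+2 :\: [set s : 'S_n | s y == y]
    = (tperm x y *: adjacent_involutions k)%g.
Proof.
move=> xE yE; have yxE : y = x.+1 :> nat by rewrite xE.
apply/setP => s; rewrite mem_lcoset tpermV !inE.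
apply/and3P/andP.
  case=> sy_neq adj /perm_on_ltP s_fix.
  have [ss _] := adjacent_involutionP _ adj.
  have sy := adjacent_involution_moved_max xE yE adj s_fix sy_neq.
  have sx : s x = y by rewrite -sy ss.
  split.
    apply: adjacent_involution_tpermM => //; last by rewrite sy; lia.
    by apply: tperm_commute; rewrite sx sy tpermC.
  apply/perm_on_ltP => i ki; rewrite permM.
  case: tpermP => [->|->|/eqP ix /eqP iy] //.
  by apply: s_fix; move: ix iy; rewrite -!val_eqE /=; lia.
case=> adj /perm_on_ltP fix_ge.
have tau_s : s = (tperm x y * (tperm x y * s))%g by rewrite mulgA tperm2 mul1g.
have [tx ty] : (tperm x y * s)%g x = x /\ (tperm x y * s)%g y = y.
  by split; apply: fix_ge; lia.
split.
- by rewrite tau_s permM tpermR tx -val_eqE /=; lia.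
- rewrite tau_s; apply: adjacent_involution_tpermM => //; last by rewrite ty.
  by apply: tperm_commute; rewrite tx ty.
- apply/perm_on_ltP => i ki; rewrite tau_s permM tpermD -?val_eqE /=; try lia.
  by apply: fix_ge; lia.
Qed.

Lemma card_adjacent_involutions k :
  k <= n -> #|adjacent_involutions k| = fib k.+1.
Proof.
elim/ltn_ind: k => -[|[|k]] IHk kn.
- by rewrite adjacent_involutions_le1 ?cards1.
- by rewrite adjacent_involutions_le1 ?cards1.
pose x := Ordinal (ltnW kn); pose y := Ordinal kn.
rewrite -(cardsID [set s : 'S_n | s y == y])
  (@adjacent_involutions_fix_max k.+1) //.
rewrite (@adjacent_involutions_move_max k x) // card_lcoset !IHk //; lia.
Qed.

End CountAdjacentInvolutions.

Lemma avoids321_theta2_fixE n (s : 'S_n) :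
  avoids pattern321 s && (theta (theta s) == s) = adjacent_involution s.
Proof.
apply/andP/idP => [[avs /eqP thetas] | adj].
  exact: theta2_fix_avoids321_adjacent.
by rewrite adjacent_involution_avoids321 // !theta_adjacent_involution.
Qed.

Theorem theorem5p3 (n : nat) (hn : 2 <= n) :
  #|[set s : 'S_n | avoids pattern321 s & theta (theta s) == s]| = fib n.+1.
Proof.
rewrite -(card_adjacent_involutions (leqnn n)); apply: eq_card => s.
rewrite !inE avoids321_theta2_fixE (_ : perm_on _ s) ?andbT //.
by apply/perm_on_ltP => i; rewrite leqNgt ltn_ord.
Qed.
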